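(* The threshold bias $b$ for the Hamiltonicity game $\mathcal{H}(E_b,n)$ is $\Theta(n)$.
   Context: $\mathcal{H}(E_b,n)$ is the following game on the edge set of $K_n$ ($n$ large): players alternate; on each turn Maker claims one unclaimed edge, and Breaker claims a set of at most $b$ pairwise vertex-disjoint unclaimed edges. The game ends when no unclaimed edges remain. Maker wins if her graph contains a Hamiltonian path of $K_n$; otherwise Breaker wins. The threshold bias is the value $b_0(n)$ such that Breaker wins if $b>b_0$ and Maker wins if $b\le b_0$. Convention: when considering Maker strategies Breaker makes the first move, and when considering Breaker strategies Maker makes the first move. *)

(* Defs.v *)
From mathcomp Require Import all_boot.

Set Implicit Arguments.
Unset Strict Implicit.
Unset Printing Implicit Defensive.

Inductive player := Maker | Breaker.

Section Game.
Variable n : nat.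

(* An edge of K_n is a 2-element set of vertices. *)
Definition edges : {set {set 'I_n}} := [set e : {set 'I_n} | #|e| == 2].

Definition adjacent (M : {set {set 'I_n}}) : rel 'I_n :=
  [rel u v | [set u; v] \in M].

Definition has_hamiltonian_path (M : {set {set 'I_n}}) : Prop :=
  exists s : seq 'I_n,
    [/\ uniq s, forall v, v \in s & sorted (adjacent M) s].

(* M and B are the edges claimed so far by Maker and by Breaker. *)
Definition unclaimed (M B : {set {set 'I_n}}) : {set {set 'I_n}} :=
  edges :\: (M :|: B).

(* Breaker may also claim no edge at all ("at most b"); the game still ends,
   since Maker has to claim an edge on each of her turns. *)
Definition breaker_move (b : nat) (M B S : {set {set 'I_n}}) : bool :=
  [&& S \subset unclaimed M B, #|S| <= b & trivIset S].

(* maker_forces b p M B: in the position (M, B) with p to move, Maker has a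
   strategy that wins against every play of Breaker.  The game is finite, so
   this is the least predicate closed under the rules below. *)
Inductive maker_forces (b : nat) :
    player -> {set {set 'I_n}} -> {set {set 'I_n}} -> Prop :=
| maker_forces_end p M B :
    unclaimed M B = set0 -> has_hamiltonian_path M -> maker_forces b p M B
| maker_forces_move M B e :
    e \in unclaimed M B -> maker_forces b Breaker (e |: M) B ->
    maker_forces b Maker M B
| maker_forces_reply M B :
    unclaimed M B <> set0 ->
    (forall S, breaker_move b M B S -> maker_forces b Maker M (S :|: B)) ->
    maker_forces b Breaker M B.

Inductive breaker_forces (b : nat) :
    player -> {set {set 'I_n}} -> {set {set 'I_n}} -> Prop :=
| breaker_forces_end p M B :
    unclaimed M B = set0 -> ~ has_hamiltonian_path M -> breaker_forces b p M B
| breaker_forces_move M B S :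
    unclaimed M B <> set0 ->
    breaker_move b M B S -> breaker_forces b Maker M (S :|: B) ->
    breaker_forces b Breaker M B
| breaker_forces_reply M B :
    unclaimed M B <> set0 ->
    (forall e, e \in unclaimed M B -> breaker_forces b Breaker (e |: M) B) ->
    breaker_forces b Maker M B.

End Game.

Definition maker_wins (first : player) (n b : nat) : Prop :=
  @maker_forces n b first set0 set0.

Definition breaker_wins (first : player) (n b : nat) : Prop :=
  @breaker_forces n b first set0 set0.

Definition is_threshold_bias (first : player) (n b0 : nat) : Prop :=
  (forall b, b0 < b -> breaker_wins first n b) /\
  (forall b, b <= b0 -> maker_wins first n b).

(* Main.v *)
(** Finite games are determined, and a larger bias only helps Breaker, so the
    threshold bias is the largest [b] for which Maker wins; it has to be bounded
    by linear functions of [n] from both sides.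

    Breaker wins when [b >= n]. Split the vertices into two copies of Z/m with
    [m] about [n/2] and colour the edges properly with [2m <= n + 1] colours:
    sums inside a copy, differences across. Breaker claims one colour class per
    turn and keeps for the end [K = 512] differences that are powers of 2; they
    form a graph without 4-cycles. At that moment Maker has at most [n + 1 - K]
    edges, so on a set [Q] of at most [2K - 2] vertices she misses [2K - 2] of
    the degrees that a Hamiltonian path needs. Few vertices of [Q] have many
    unclaimed edges inside [Q]; without them, maximal matchings use up the
    unclaimed edges inside [Q] in [K/4] turns. Each later Maker edge repairs only
    one missing degree, while the remaining [K] colour classes end the game in
    [K] turns, which is too soon.

    Maker wins when [b <= n / 3827]. She keeps one path and repeatedly absorbs
    the vertex [w] off the path with the most Breaker edges, in two or three
    turns, by creating two threats at a common vertex: Breaker's edges are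
    disjoint, so he blocks only one of them. Breaker has too few edges to make
    many vertices dangerous, and a dangerous vertex is absorbed before its
    Breaker degree becomes an obstacle. *)

Require Import Defs.
From mathcomp Require Import all_boot zify.
From mathcomp Require Import boolp.

Set Implicit Arguments.
Unset Strict Implicit.
Unset Printing Implicit Defensive.

(** * Positions of the game *)

Section Positions.
Variable n : nat.
Implicit Types (M B S : {set {set 'I_n}}) (e : {set 'I_n}) (u v w : 'I_n).

Lemma mem_unclaimed M B e :
  (e \in unclaimed M B) = [&& #|e| == 2, e \notin M & e \notin B].
Proof. by rewrite !inE negb_or andbC. Qed.

Lemma pair_unclaimed M B u v : u != v ->
  ([set u; v] \in unclaimed M B) = ([set u; v] \notin M) && ([set u; v] \notin B).
Proof. by move=> uv; rewrite mem_unclaimed cards2 uv. Qed.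

Lemma unclaimed_move_sub M B S e :
  unclaimed (e |: M) (S :|: B) \subset unclaimed M B.
Proof.
apply/subsetP=> f; rewrite !mem_unclaimed !inE !negb_or.
by case/and3P=> -> /andP[_ ->] /andP[_ ->].
Qed.

Lemma card_unclaimed_move M B e :
  e \in unclaimed M B -> #|unclaimed (e |: M) B| < #|unclaimed M B|.
Proof.
move=> eU; apply: proper_card; apply/properP; split.
  by have := unclaimed_move_sub M B set0 e; rewrite set0U.
by exists e; rewrite // mem_unclaimed setU11 andbF.
Qed.

Lemma breaker_move0 b M B : breaker_move b M B set0.
Proof. by rewrite /breaker_move sub0set cards0; apply/trivIsetP=> A C; rewrite inE. Qed.

Lemma hamiltonian_path_subset M M' :
  M \subset M' -> has_hamiltonian_path M -> has_hamiltonian_path M'.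
Proof.
move=> MM' [s [us cs ss]]; exists s; split=> //.
by apply: sub_sorted ss => u v /=; apply: (subsetP MM').
Qed.

(** The path persists while Maker's graph grows, so she may play any edge; each one shrinks the
    board. *)
Lemma maker_forces_hamiltonian b p M B :
  has_hamiltonian_path M -> maker_forces b p M B.
Proof.
have [k] := ubnP #|unclaimed M B|; elim: k p M B => // k IH p M B lek hM.
have [U0|[e eU]] := set_0Vmem (unclaimed M B); first exact: maker_forces_end.
have next S : maker_forces b Maker M (S :|: B).
  have [U0|[f fU]] := set_0Vmem (unclaimed M (S :|: B)).
    exact: maker_forces_end.
  apply: (maker_forces_move fU); apply: IH.
    apply: leq_trans (card_unclaimed_move fU) _.
    apply: leq_trans (_ : #|unclaimed M B| <= k); last by [].
    apply: subset_leq_card; apply/subsetP=> g.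
    by rewrite !mem_unclaimed !inE negb_or; case/and3P=> -> -> /andP[].
  exact: hamiltonian_path_subset (subsetUr _ _) hM.
case: p; first by have := next set0; rewrite set0U.
by apply: maker_forces_reply => [U0|S _]; [rewrite U0 inE in eU | apply: next].
Qed.

(** One full round. If [e] fills the board, no reply rule applies, but the empty reply in the
    hypothesis shows that the final position is won. *)
Lemma maker_forces_turn b M B e :
  e \in unclaimed M B ->
  (forall S, breaker_move b (e |: M) B S ->
     maker_forces b Maker (e |: M) (S :|: B)) ->
  maker_forces b Maker M B.
Proof.
move=> eU H; apply: (maker_forces_move eU).
have [U0|/eqP U0] := eqVneq (unclaimed (e |: M) B) set0; last first.
  exact: maker_forces_reply.
apply: maker_forces_end => //; have := H _ (breaker_move0 _ _ _); rewrite set0U.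
by move=> HM; inversion HM as [p' M' B' _ hM|M' B' f fU|]; subst=> //; rewrite U0 inE in fU.
Qed.

Lemma breaker_forces_end_inv b p M B :
  unclaimed M B = set0 -> breaker_forces b p M B -> ~ has_hamiltonian_path M.
Proof. by move=> U0 H; case: H U0. Qed.

Lemma breaker_forces_turn b M B :
  (unclaimed M B = set0 -> ~ has_hamiltonian_path M) ->
  (forall e, e \in unclaimed M B ->
     exists2 S, breaker_move b (e |: M) B S &
                breaker_forces b Maker (e |: M) (S :|: B)) ->
  breaker_forces b Maker M B.
Proof.
move=> H0 H; have [U0|/eqP U0] := eqVneq (unclaimed M B) set0.
  by apply: breaker_forces_end => //; apply: H0.
apply: breaker_forces_reply => // e /H[S mS HS].
have [V0|/eqP V0] := eqVneq (unclaimed (e |: M) B) set0; last first.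
  exact: breaker_forces_move mS HS.
apply: breaker_forces_end => //; apply: breaker_forces_end_inv HS.
by case/and3P: mS; rewrite V0 subset0 => /eqP-> _ _; rewrite set0U.
Qed.

Lemma forces_exclusive b p M B :
  maker_forces b p M B -> ~ breaker_forces b p M B.
Proof.
elim=> {p M B} [p M B U0 hM|M B e eU _ IH|M B U0 _ IH] H.
- exact: breaker_forces_end_inv H hM.
- inversion H as [p' M' B' U0|M' B' S|M' B' U0 H']; subst.
    by rewrite U0 inE in eU.
  exact: IH (H' _ eU).
- inversion H as [p' M' B' U1|M' B' S U1 mS H'|M' B' U1 H']; subst=> //.
  exact: IH mS H'.
Qed.

Lemma maker_forces_antimono b b' p M B :
  b' <= b -> maker_forces b p M B -> maker_forces b' p M B.
Proof.
move=> bb; elim=> {p M B} [p M B U0 hM|M B e eU _ IH|M B U0 _ IH].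
- exact: maker_forces_end.
- exact: maker_forces_move eU IH.
- apply: maker_forces_reply => // S /and3P[sS cS tS]; apply: IH.
  by rewrite /breaker_move sS tS (leq_trans cS).
Qed.

End Positions.

(** * Degrees and deficiency *)

Section Degrees.
Variable n : nat.
Implicit Types (M B S E : {set {set 'I_n}}) (e : {set 'I_n}) (u v w : 'I_n).

Definition degree E v := #|[set e in E | v \in e]|.

Lemma sum_degree E : \sum_v degree E v = \sum_(e in E) #|e|.
Proof.
rewrite [RHS](eq_bigr (fun e => \sum_(v : 'I_n) (v \in e : nat))) => [|e _].
  rewrite exchange_big; apply: eq_bigr => v _; rewrite /degree -sum1_card.
  rewrite big_mkcond [RHS]big_mkcond; apply: eq_bigr => e _ /=.
  by rewrite !inE; case: (e \in E); case: (v \in e).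
by rewrite -sum1_card big_mkcond; apply: eq_bigr => v _; case: (v \in e).
Qed.

Lemma sum_degree_edges E : E \subset edges n -> \sum_v degree E v = 2 * #|E|.
Proof.
move=> /subsetP sE; rewrite sum_degree (eq_bigr (fun=> 2)) => [|e /sE].
  by rewrite sum_nat_const mulnC.
by rewrite inE => /eqP.
Qed.

Lemma degree_setU1 E e v : degree (e |: E) v <= degree E v + (v \in e).
Proof.
rewrite /degree; case: (boolP (v \in e)) => ve.
  apply: leq_trans (_ : #|e |: [set f in E | v \in f]| <= _); last first.
    by rewrite cardsU1 addnC leq_add2l; case: (_ \notin _).
  apply: subset_leq_card; apply/subsetP=> f; rewrite !inE.
  by case/andP=> /orP[->|->] // ->; rewrite orbT.
rewrite addn0; apply: subset_leq_card; apply/subsetP=> f; rewrite !inE.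
by case/andP=> /orP[/eqP->|->] // ve'; rewrite ve' in ve.
Qed.

Lemma trivIset_meet S e f v :
  trivIset S -> e \in S -> f \in S -> v \in e -> v \in f -> e = f.
Proof.
move=> /trivIsetP tS eS fS ve vf; apply/eqP; apply/negPn/negP=> nef.
by have /pred0P/(_ v) := tS _ _ eS fS nef; rewrite /= ve vf.
Qed.

Lemma degree_trivIset S v : trivIset S -> degree S v <= 1.
Proof.
move=> tS; apply/card_le1_eqP=> e f; rewrite !inE => /andP[eS ve] /andP[fS vf].
exact: (trivIset_meet tS fS eS vf ve).
Qed.

Lemma degree_setU E E' v : degree (E :|: E') v <= degree E v + degree E' v.
Proof.
rewrite /degree; apply: leq_trans (leq_card_setU _ _).
apply: subset_leq_card; apply/subsetP=> f; rewrite !inE.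
by case/andP=> /orP[]-> ->; rewrite ?orbT.
Qed.

Lemma card_neighbours E v (A : {set 'I_n}) :
  #|[set u in A | [set v; u] \in E]| <= degree E v.
Proof.
have inj : {in [set u in A | [set v; u] \in E] &, injective (fun u => [set v; u])}.
  move=> u w _ _ /= /setP eq; have := eq w; have := eq u; rewrite !inE !eqxx !orbT.
  case: (eqVneq u v) => [->|_] /= Hu Hw; last exact/eqP/esym.
  by move: Hw; rewrite orbb => /eqP->.
rewrite -(card_in_imset inj); apply: subset_leq_card; apply/subsetP=> e /imsetP[u].
by rewrite inE => /andP[_ vuE] ->; rewrite inE vuE set21.
Qed.

Lemma card_matching S : S \subset edges n -> trivIset S -> #|S| <= n.
Proof.
move=> sS tS; have := sum_degree_edges sS.
have : \sum_v degree S v <= \sum_(v : 'I_n) 1.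
  by apply: leq_sum => v _; apply: degree_trivIset.
rewrite sum1_card card_ord; lia.
Qed.

(** The subtraction is truncated: surplus degree at one vertex cannot make up for a lack at
    another. *)
Definition deficiency M (Q : {set 'I_n}) := \sum_(v in Q) (2 - degree M v).

Lemma deficiency_move M e Q :
  deficiency M Q <= deficiency (e |: M) Q + #|Q :&: e|.
Proof.
have -> : #|Q :&: e| = \sum_(v in Q) (v \in e : nat).
  rewrite -sum1_card big_mkcond [RHS]big_mkcond; apply: eq_bigr => v _.
  by rewrite inE; case: (v \in Q); case: (v \in e).
rewrite /deficiency -big_split; apply: leq_sum => v _ /=.
have := degree_setU1 M e v; lia.
Qed.

Lemma degree_path_end M u v : [set u; v] \in M -> 0 < degree M u.
Proof. by move=> uvM; apply/card_gt0P; exists [set u; v]; rewrite inE uvM set21. Qed.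

Lemma degree_path_inner M u v w : u != w ->
  [set u; v] \in M -> [set v; w] \in M -> 1 < degree M v.
Proof.
move=> uw uvM vwM; apply/card_gt1P; exists [set u; v], [set v; w].
rewrite !inE uvM vwM !eqxx orbT /=; split=> //.
apply: contra_neq uw => /setP eq; have := eq u; have := eq w.
rewrite !inE !eqxx !orbT /=.
by case/orP=> /eqP // ->; rewrite orbb => /esym/eqP.
Qed.

(** Inner path vertices have degree at least 2 and each end lacks at most one; the vertex of a
    one-vertex path counts as both ends. *)
Lemma hamiltonian_deficiency M Q : has_hamiltonian_path M -> deficiency M Q <= 2.
Proof.
case=> s [us cs ss].
case: s us cs ss => [|x p] us cs ss.
  by rewrite /deficiency big1 // => v; have := cs v.
have le v : 2 - degree M v <= (v == x) + (v == last x p).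
  have := cs v; rewrite in_cons; case: (eqVneq v x) => [->|vx] /=.
    case: p us cs ss => [|y p] us cs /=; first by rewrite eqxx; lia.
    by case/andP=> /degree_path_end; lia.
  move=> vp; case/splitPr: vp us cs ss => [p1 p2].
  rewrite last_cat /= cat_path /= => /andP[xp up] _ /and3P[_ h1 h2].
  case: p2 h2 xp up => [|y p2] /=.
    by move: h1; rewrite eqxx /adjacent /= setUC => /degree_path_end; lia.
  case/andP=> h2 _ xp up; have : last x p1 != y.
    apply/eqP=> eqy; have := mem_last x p1; rewrite eqy in_cons.
    case/orP=> [/eqP yx|yp1]; first by rewrite mem_cat yx !in_cons eqxx !orbT in xp.
    move: up; rewrite cat_uniq => /and3P[_ /hasPn/(_ y)].
    by rewrite !inE eqxx orbT yp1 => /(_ isT).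
  by move=> /degree_path_inner/(_ h1 h2); lia.
have : deficiency M Q <= \sum_(v in Q) ((v == x) + (v == last x p)).
  by apply: leq_sum => v _; apply: le.
rewrite big_split /=.
have one z : \sum_(v in Q) (v == z : nat) <= 1.
  rewrite big_mkcond (bigD1 z) //= big1 ?addn0; first by case: (z \in Q); rewrite ?eqxx.
  by move=> v /negbTE->; case: (v \in Q).
by move/leq_trans; apply; apply: (leq_add (one x) (one (last x p))).
Qed.

End Degrees.

(** * Breaker's colouring strategy *)

Section BreakerStrategy.
Variables (n b : nat) (col : 'I_n -> 'I_n -> nat).
Hypothesis nb : n <= b.
Hypothesis colC : forall u v, col u v = col v u.
Hypothesis colI : forall u, injective (col u).
Implicit Types (M B S : {set {set 'I_n}}) (e : {set 'I_n}) (u v w : 'I_n)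
  (cs : seq nat) (Q : {set 'I_n}).

Definition colour_class c : {set {set 'I_n}} :=
  [set e | [exists u, exists v, (e == [set u; v]) && (col u v == c)]].

(** Claiming one class of [cs] per turn, Breaker ends the game within [size cs] turns. *)
Definition coloured_in cs M B :=
  forall u v, [set u; v] \in unclaimed M B -> col u v \in cs.

(** A matching has at most [n <= b] edges, so the bias never binds. *)
Lemma breaker_moveE M B S :
  breaker_move b M B S = (S \subset unclaimed M B) && trivIset S.
Proof.
rewrite /breaker_move; case: (boolP (S \subset _)) => //= sS.
case: (boolP (trivIset S)) => //= tS; rewrite ?andbF // andbT.
apply: leq_trans nb; apply: card_matching tS.
exact: subset_trans sS (subsetDl _ _).
Qed.

Lemma colour_classP c e v : e \in colour_class c -> v \in e ->
  exists2 w, e = [set v; w] & col v w = c.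
Proof.
rewrite inE => /existsP[x /existsP[y /andP[/eqP-> /eqP cxy]]].
by rewrite !inE => /orP[]/eqP->; [exists y | exists x; [rewrite setUC | rewrite colC]].
Qed.

Lemma trivIset_colour_class c : trivIset (colour_class c).
Proof.
apply/trivIsetP=> e f ec fc; apply: contraR => /pred0Pn[v /andP[/= ve vf]].
have [x -> cx] := colour_classP ec ve; have [y -> cy] := colour_classP fc vf.
by rewrite (colI (etrans cx (esym cy))).
Qed.

Lemma breaker_move_colour M B c :
  breaker_move b M B (unclaimed M B :&: colour_class c).
Proof.
rewrite breaker_moveE subsetIl; apply: trivIsetS (trivIset_colour_class c).
exact: subsetIr.
Qed.

Lemma coloured_in_move cs M B e S :
  coloured_in cs M B -> coloured_in cs (e |: M) (S :|: B).
Proof. by move=> H u v uvU; apply: H; apply: subsetP uvU; apply: unclaimed_move_sub. Qed.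

Lemma coloured_in_colour c cs M B : coloured_in (c :: cs) M B ->
  coloured_in cs M (unclaimed M B :&: colour_class c :|: B).
Proof.
move=> H u v; rewrite mem_unclaimed !in_setU !in_setI !negb_or.
case/and4P=> uv uvM uvS uvB.
have uvU : [set u; v] \in unclaimed M B by rewrite mem_unclaimed uv uvM.
have := H _ _ uvU; rewrite inE => /orP[/eqP cuv|//].
move: uvS; rewrite uvU inE /= => /existsP[]; exists u.
by apply/existsP; exists v; rewrite cuv !eqxx.
Qed.

Lemma unclaimed_pair M B e u v :
  e \in unclaimed M B -> u \in e -> v \in e -> u != v -> e = [set u; v].
Proof.
rewrite mem_unclaimed => /and3P[/eqP e2 _ _] ue ve uv.
by apply/esym/eqP; rewrite eqEcard subUset !sub1set ue ve cards2 uv e2.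
Qed.

Lemma card_unclaimed M B e : e \in unclaimed M B -> #|e| = 2.
Proof. by rewrite mem_unclaimed => /andP[/eqP]. Qed.

(** Each Maker edge has at most one end in [Q] and lowers the deficiency by at most 1, while Breaker
    removes one colour. At the end at least 3 is left, one more than a Hamiltonian path allows. *)
Lemma breaker_wins_independent cs M B Q :
  coloured_in cs M B ->
  (forall u v, u \in Q -> v \in Q -> [set u; v] \notin unclaimed M B) ->
  size cs + 3 <= deficiency M Q -> breaker_forces b Maker M B.
Proof.
elim: cs M B => [|c cs IH] M B cU indQ defQ; apply: breaker_forces_turn => /=.
- by move=> _ /(@hamiltonian_deficiency _ _ Q); lia.
- move=> e eU; have /cards2P[u [v [_ euv]]] := introT eqP (card_unclaimed eU).
  by have := cU u v; rewrite -euv => /(_ eU).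
- by move=> _ /(@hamiltonian_deficiency _ _ Q); move: defQ => /=; lia.
move=> e eU; exists (unclaimed (e |: M) B :&: colour_class c).
  exact: breaker_move_colour.
apply: IH => [|u v uQ vQ|].
- apply: coloured_in_colour.
  by have := @coloured_in_move _ _ _ e set0 cU; rewrite set0U.
- by apply: contra (indQ u v uQ vQ); apply: subsetP; apply: unclaimed_move_sub.
have : #|Q :&: e| <= 1.
  apply/card_le1_eqP=> u v; rewrite !inE => /andP[uQ ue] /andP[vQ ve].
  apply/eqP/negPn/negP => vu; have := indQ _ _ vQ uQ.
  by rewrite -(unclaimed_pair eU) // eU.
by have := deficiency_move M e Q; move: defQ => /=; lia.
Qed.

Definition free_neighbours M B Q v := [set w in Q | [set v; w] \in unclaimed M B].
Definition free_degree M B Q v := #|free_neighbours M B Q v|.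

Lemma mem_free_neighbours M B Q v w :
  (w \in free_neighbours M B Q v) = (w \in Q) && ([set v; w] \in unclaimed M B).
Proof. by rewrite in_set. Qed.

(** By maximality, every unclaimed edge that survives inside [Q] has an end covered by [S], and that
    end loses a free neighbour. *)
Lemma maximal_matching M B Q : exists S,
  [/\ breaker_move b M B S,
      forall u, free_degree M (S :|: B) Q u <= free_degree M B Q u &
      forall u v, u \in Q -> v \in Q -> [set u; v] \in unclaimed M (S :|: B) ->
        free_degree M (S :|: B) Q u + free_degree M (S :|: B) Q v <
        free_degree M B Q u + free_degree M B Q v].
Proof.
pose A := [set e in unclaimed M B | e \subset Q].
have [|S /maxsetP[/andP[sSA tS] maxS]] :=
    @ex_maxset _ (fun S => (S \subset A) && trivIset S).
  by exists set0; rewrite sub0set; apply/trivIsetP=> C D; rewrite inE.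
have sSU : S \subset unclaimed M B.
  by apply: subset_trans sSA _; apply/subsetP=> e; rewrite in_set => /andP[].
have sub e : e \in unclaimed M (S :|: B) -> e \in unclaimed M B.
  by rewrite !mem_unclaimed !inE !negb_or => /and4P[-> -> _ ->].
have le u : free_degree M (S :|: B) Q u <= free_degree M B Q u.
  by apply: subset_leq_card; apply/subsetP=> w; rewrite !mem_free_neighbours => /andP[-> /sub].
have lt u (f : {set 'I_n}) : u \in f -> f \in S ->
    free_degree M (S :|: B) Q u < free_degree M B Q u.
  move=> uf fS; have fA := subsetP sSA _ fS; have fU := subsetP sSU _ fS.
  have /cards2P[x [y [xy fxy]]] := introT eqP (card_unclaimed fU).
  have [w wf wu] : exists2 w, w \in f & w != u.
    move: uf; rewrite fxy !inE => /orP[]/eqP->; [exists y | exists x] => //.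
    - by rewrite set22.
    - by rewrite eq_sym.
    - by rewrite set21.
  have fuw : f = [set u; w] by apply: unclaimed_pair fU uf wf _; rewrite eq_sym.
  apply: proper_card; apply/properP; split.
    by apply/subsetP=> z; rewrite !mem_free_neighbours => /andP[-> /sub].
  exists w.
    rewrite mem_free_neighbours -fuw fU andbT.
    by move: fA; rewrite in_set => /andP[_ /subsetP]; apply.
  by rewrite mem_free_neighbours -fuw mem_unclaimed !inE fS !andbF.
exists S; split=> //; first by rewrite breaker_moveE sSU.
move=> u v uQ vQ uvU.
case: (boolP [exists f in S, ~~ [disjoint [set u; v] & f]]).
  case/existsP=> f /andP[fS /pred0Pn[x /andP[/= xuv xf]]].
  have := lt _ _ xf fS; have := le u; have := le v.
  move: xuv; rewrite !inE => /orP[]/eqP->.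
    by rewrite -addSn => ? ? ?; apply: leq_add.
  by rewrite -addnS => ? ? ?; apply: leq_add.
rewrite negb_exists => /forallP noS.
have uvA : [set u; v] \in A by rewrite in_set (sub _ uvU) subUset !sub1set uQ vQ.
have [] := @trivIsetU1 _ [set u; v] S.
- by move=> f fS; have := noS f; rewrite fS negbK.
- by [].
- by apply/negP=> /(subsetP sSU); rewrite mem_unclaimed cards0.
move=> tS' /negP[]; rewrite -(maxS ([set u; v] |: S)) ?setU11 ?subsetUr //.
by rewrite tS' subUset sub1set uvA sSA.
Qed.

(** Each maximal matching lowers the sum of free degrees along every surviving edge, so [j] turns
    leave no unclaimed edge inside [Q]. Maker repairs at most two degrees per turn, hence
    [2 * j]. *)
Lemma breaker_wins_sparse j cs M B Q :
  coloured_in cs M B ->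
  (forall u v, u \in Q -> v \in Q -> [set u; v] \in unclaimed M B ->
     free_degree M B Q u + free_degree M B Q v <= j) ->
  2 * j + size cs + 3 <= deficiency M Q -> breaker_forces b Maker M B.
Proof.
elim: j M B => [|j IH] M B cU degQ defQ.
  apply: (@breaker_wins_independent cs _ _ Q) => //.
  move=> u v uQ vQ; apply/negP=> uvU; have := degQ _ _ uQ vQ uvU.
  rewrite leqn0 addn_eq0 => /andP[/eqP/cards0_eq/setP/(_ v)].
  by rewrite mem_free_neighbours vQ uvU inE.
apply: breaker_forces_turn => [_ /(@hamiltonian_deficiency _ _ Q)|e eU]; first lia.
have [S [mS leS ltS]] := maximal_matching (e |: M) B Q.
exists S => //; apply: IH => [|u v uQ vQ uvU|].
- exact: coloured_in_move.
- have le w : free_degree (e |: M) B Q w <= free_degree M B Q w.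
    apply: subset_leq_card; apply/subsetP=> z; rewrite !mem_free_neighbours.
    case/andP=> -> zU /=; have := unclaimed_move_sub M B set0 e; rewrite set0U.
    by move/subsetP; apply.
  have := ltS _ _ uQ vQ uvU; have := le u; have := le v.
  have := degQ u v uQ vQ (subsetP (unclaimed_move_sub M B S e) _ uvU); lia.
have : #|Q :&: e| <= 2 by rewrite -(card_unclaimed eU) subset_leq_card // subsetIr.
by have := deficiency_move M e Q; move: defQ; lia.
Qed.

Lemma breaker_wins_opening cs cs' X M B :
  M \subset edges n -> coloured_in (cs ++ cs') M B -> #|M| + size cs <= X ->
  (forall M' B', M' \subset edges n -> coloured_in cs' M' B' -> #|M'| <= X ->
     breaker_forces b Maker M' B') ->
  breaker_forces b Maker M B.
Proof.
move=> sM cU cM H; elim: cs M B sM cU cM => [|c cs IH] M B sM cU cM.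
  by apply: H => //; move: cM; rewrite addn0.
apply: breaker_forces_turn => [U0|e eU].
  (* The board may fill up before [cs] is used; then the colour condition is vacuous and [H] applies
     at once. *)
  have : breaker_forces b Maker M B.
    apply: H => //; last exact: leq_trans (leq_addr _ _) cM.
    by move=> u v; rewrite U0 inE.
  exact: breaker_forces_end_inv.
exists (unclaimed (e |: M) B :&: colour_class c); first exact: breaker_move_colour.
apply: IH.
- by rewrite subUset sM andbT sub1set inE (card_unclaimed eU).
- apply: coloured_in_colour.
  by have := @coloured_in_move _ _ _ e set0 cU; rewrite set0U.
- by move: cM; rewrite cardsU1 /=; case: (_ \notin _); lia.
Qed.

End BreakerStrategy.

(** * Breaker wins for large bias *)

(** Greedy choice: while the weight of [Q] is too small, some element outside has positive
    weight. *)
Lemma small_heavy_subset (T : finType) (f : T -> nat) t : t <= \sum_x f x ->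
  exists Q : {set T}, #|Q| <= t <= \sum_(x in Q) f x.
Proof.
elim: t => [|t IH] tf; first by exists set0; rewrite cards0.
have [Q /andP[cQ sQ]] := IH (ltnW tf).
have [ltQ|leQ] := ltnP t (\sum_(x in Q) f x); first by exists Q; rewrite leqW.
have /existsP[x /andP[xQ fx]] : [exists x, (x \notin Q) && (0 < f x)].
  apply: contraLR tf; rewrite negb_exists => /forallP noQ; rewrite -leqNgt.
  apply: leq_trans leQ; rewrite [X in _ <= X]big_mkcond; apply: leq_sum => x _.
  by have := noQ x; rewrite negb_and; case: (x \in Q) => //= /[!lt0n]/negPn/eqP->.
exists (x |: Q); rewrite cardsU1 xQ big_setU1 //=; lia.
Qed.

(** Each set shares at most one element with each other set, so it adds at least [d] minus their
    number to the union. *)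
Lemma union_almost_disjoint (I : eqType) (T : finType) (N : I -> {set T}) d s :
  uniq s -> {in s, forall i, d <= #|N i|} ->
  {in s &, forall i j, i != j -> #|N i :&: N j| <= 1} ->
  size s * d <= #|\bigcup_(i <- s) N i| + size s * size s.
Proof.
elim: s => [|x s IH] //= /andP[xs us] dN interN.
have dx := dN x (mem_head _ _).
have {}IH : size s * d <= #|\bigcup_(i <- s) N i| + size s * size s.
  apply: IH => // [i si|i j si sj]; first by apply: dN; rewrite inE si orbT.
  by apply: interN; rewrite inE ?si ?sj orbT.
have : #|N x :&: \bigcup_(i <- s) N i| <= size s.
  have : {in s, forall i, #|N x :&: N i| <= 1}.
    move=> i si; apply: interN; rewrite ?mem_head ?inE ?si ?orbT //.
    by apply: contraNneq xs => ->.
  elim: {IH us dN interN xs} s => [|y s IH] H; first by rewrite big_nil setI0 cards0.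
  rewrite big_cons setIUr; apply: leq_trans (leq_card_setU _ _) _.
  rewrite -[size _]/(1 + size s) leq_add ?H ?mem_head // IH // => i si.
  by apply: H; rewrite inE si orbT.
have := cardsUI (N x) (\bigcup_(i <- s) N i); rewrite big_cons; nia.
Qed.

(** * The endgame on colours without 4-cycles *)

Section Middle.
Variables (n b : nat) (col : 'I_n -> 'I_n -> nat).
Hypothesis nb : n <= b.
Hypothesis colC : forall u v, col u v = col v u.
Hypothesis colI : forall u, injective (col u).

(* The colours of cs form a graph without 4-cycles, so fewer than 32 vertices
   of Q have 64 or more unclaimed edges inside Q. *)
Lemma breaker_wins_C4_free cs (M B : {set {set 'I_n}}) :
  (forall u v x y, u != v -> col u x \in cs -> col u y \in cs ->
     col v x \in cs -> col v y \in cs -> x = y) ->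
  size cs = 512 -> M \subset edges n -> coloured_in col cs M B ->
  #|M| + 512 <= n.+1 -> breaker_forces b Maker M B.
Proof.
move=> C4 scs sM cU cM.
(* The total deficiency is at least 2n - 2|M| >= 2 * 512 - 2 = 1022. *)
have [|Q /andP[cQ defQ]] := @small_heavy_subset _ (fun v => 2 - degree M v) 1022.
  have : \sum_(v : 'I_n) 2 <= \sum_v (2 - degree M v) + \sum_v degree M v.
    by rewrite -big_split; apply: leq_sum => v _ /=; lia.
  rewrite sum_degree_edges // sum_nat_const card_ord; lia.
pose Big := [set v in Q | 64 <= free_degree M B Q v].
have cBig : #|Big| < 32.
  (* Otherwise 32 neighbourhoods of size 64 or more, pairwise sharing at most one vertex, would
     cover at least 32 * 64 - 32 * 32 = 1024 > 1022 vertices of [Q]. *)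
  rewrite ltnNge; apply/negP=> /card_geqP[s [us ss sBig]].
  have := @union_almost_disjoint _ _ (free_neighbours M B Q) 64 s us.
  rewrite ss => H; suff : #|\bigcup_(i <- s) free_neighbours M B Q i| <= #|Q|.
    have := H _ _; set c := #|_| => {}H cc.
    have : 32 * 64 <= c + 32 * 32; last lia.
    apply: H => [i /sBig|i j si sj ij]; first by rewrite in_set => /andP[].
    apply/card_le1_eqP=> x y; rewrite !in_setI !mem_free_neighbours.
    case/andP=> /andP[_ ix] /andP[_ jx] /andP[/andP[_ iy] /andP[_ jy]].
    by apply: C4 ij _ _ _ _; apply: cU.
  apply: subset_leq_card; elim: {us ss sBig H} s => [|x s IH].
    by rewrite big_nil sub0set.
  rewrite big_cons subUset IH andbT; apply/subsetP=> y.
  by rewrite mem_free_neighbours => /andP[].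
(* Two free degrees below 64 sum to less than 128. The budget suffices: 1022 - 2 * 31 = 960 >= 2 *
   128 + 512 + 3. *)
apply: (@breaker_wins_sparse _ _ _ nb colC colI 128 cs _ _ (Q :\: Big)) => //.
  have le u : u \in Q :\: Big -> free_degree M B (Q :\: Big) u < 64.
    rewrite !inE => /andP[+ uQ]; rewrite uQ -ltnNge; apply: leq_ltn_trans.
    apply: subset_leq_card; apply/subsetP=> w; rewrite !mem_free_neighbours.
    by case/andP=> /setDP[-> _].
  by move=> u v /le + /le + _; lia.
rewrite scs; have : deficiency M Q <= deficiency M (Q :\: Big) + 2 * #|Big|.
  rewrite /deficiency (big_setID Big) /= addnC leq_add2l.
  apply: leq_trans (_ : \sum_(v in Q :&: Big) 2 <= _).
    by apply: leq_sum => v _; lia.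
  by rewrite sum_nat_const mulnC leq_mul2l subset_leq_card // subsetIr.
by move: defQ; rewrite -/(deficiency M Q); lia.
Qed.

End Middle.

(** Powers of 2 form a Sidon set: an exponent 0 is settled by parity and size, otherwise both sides
    are halved. *)
Lemma pow2_sum_inj i j k l : 2 ^ i + 2 ^ l = 2 ^ j + 2 ^ k ->
  (i = j /\ l = k) \/ (i = k /\ l = j).
Proof.
have inj x y : 2 ^ x = 2 ^ y -> x = y by apply: expnI.
elim: i j k l => [|i IH] [|j] [|k] [|l]; rewrite ?expn0 ?expnS; try lia.
- by move=> H; left; rewrite (inj l k) //; lia.
- by move=> H; right; rewrite (inj l j) //; lia.
- by move=> H; right; rewrite (inj i k) //; lia.
- by move=> H; left; rewrite (inj i j) //; lia.
by move=> H; have [|[-> ->]|[-> ->]] := IH j k l; [lia|left|right].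
Qed.

(** * A proper edge colouring by sums and differences in Z/m *)

Section Colouring.
Variable m : nat.

(** The difference y - x in Z/m, for [x < m]. *)
Definition shift x y := (y + (m - x)) %% m.

Lemma shiftK x y : x < m -> y < m -> (x + shift x y) %% m = y.
Proof.
move=> xm ym; rewrite modnDmr (_ : x + _ = y + m); last lia.
by rewrite modnDr modn_small.
Qed.

(** Eliminating [x] and [y] gives [2 ^ i + 2 ^ l = 2 ^ j + 2 ^ k] modulo [m]. Both sides are at most
    [2 ^ K < m], so this is an equality of naturals. *)
Lemma sidon_mod K x y i j k l : 2 ^ K < m -> x < m -> y < m ->
  [/\ i < K, j < K, k < K & l < K] ->
  x + 2 ^ i = y + 2 ^ j %[mod m] -> x + 2 ^ k = y + 2 ^ l %[mod m] ->
  i = k \/ x = y.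
Proof.
move=> Km xm ym [iK jK kK lK] eq1 eq2.
have small a c : a < K -> c < K -> 2 ^ a + 2 ^ c < m.
  move=> aK cK; apply: leq_ltn_trans Km; case: K aK cK {iK jK kK lK} => // K aK cK.
  by rewrite expnS mul2n -addnn leq_add // leq_exp2l.
have eq3 : 2 ^ i + 2 ^ l = 2 ^ j + 2 ^ k.
  rewrite -[LHS](@modn_small _ m) ?small // -[RHS](@modn_small _ m) ?small //.
  apply/eqP; rewrite -(eqn_modDl (x + y)).
  rewrite (_ : _ + (_ + _) = (x + 2 ^ i) + (y + 2 ^ l)); last lia.
  rewrite (_ : x + y + _ = (y + 2 ^ j) + (x + 2 ^ k)); last lia.
  by rewrite -modnDm eq1 -eq2 modnDm.
have [[ij _]|[ik _]] := pow2_sum_inj eq3; last by left.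
right; rewrite -(modn_small xm) -(modn_small ym); apply/eqP.
by rewrite -(eqn_modDr (2 ^ i)) eq1 ij.
Qed.

(* Vertex i stands for the element i./2 of Z/m on side odd i: an edge inside a
   side is coloured by the sum of its ends, a crossing edge by m plus their
   difference. *)
Definition edge_colour (u v : nat) :=
  if odd u == odd v then (u./2 + v./2) %% m
  else m + (if odd v then shift u./2 v./2 else shift v./2 u./2).

Lemma edge_colourC u v : edge_colour u v = edge_colour v u.
Proof.
rewrite /edge_colour eq_sym addnC; case: ifP => //.
by case: (odd u); case: (odd v).
Qed.

Lemma edge_colour_lt u v : 0 < m -> edge_colour u v < 2 * m.
Proof.
move=> m0; rewrite /edge_colour /shift; case: ifP => _; last case: ifP => _.
all: by have := ltn_pmod; move/(_ _ _ m0) => H; rewrite ?mul2n -?addnn ?ltn_add2l ?H ?ltn_addr ?H.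
Qed.

(** The colouring is proper: sums lie below [m] and differences do not, so the colour fixes the side
    of [v], and cancellation in Z/m fixes [v]. *)
Lemma edge_colour_inj u v w : u./2 < m -> v./2 < m -> w./2 < m ->
  edge_colour u v = edge_colour u w -> v = w.
Proof.
move=> um vm wm; have m0 : 0 < m by apply: leq_ltn_trans um.
have half_inj : odd v = odd w -> v./2 = w./2 -> v = w.
  by move=> o h; rewrite -(odd_double_half v) -(odd_double_half w) o h.
have mod_lt x : x %% m < m by rewrite ltn_mod.
rewrite /edge_colour; case: eqP => ov; case: eqP => ow.
- move=> /eqP; rewrite eqn_modDl !modn_small // => /eqP; apply: half_inj.
  by rewrite -ov.
- by have := mod_lt (u./2 + v./2); lia.
- by have := mod_lt (u./2 + w./2); lia.
have ovw : odd v = odd w by case: (odd u) (odd v) (odd w) ov ow => [] [] [].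
move/addnI; rewrite -ovw; case: (odd v) => eq; apply: half_inj => //.
  by rewrite -(shiftK um vm) eq shiftK.
have := shiftK vm um; rewrite eq -[RHS](shiftK wm um) => /eqP.
by rewrite eqn_modDr !modn_small // => /eqP.
Qed.

Definition sidon_colours K := [seq m + 2 ^ i | i <- iota 0 K].

Lemma sidon_coloursP K u v : u./2 < m -> v./2 < m ->
  edge_colour u v \in sidon_colours K ->
  exists2 i, i < K & odd u != odd v /\
    (if odd v then v./2 = (u./2 + 2 ^ i) %% m else u./2 = (v./2 + 2 ^ i) %% m).
Proof.
move=> um vm /mapP[i]; rewrite mem_iota add0n => /andP[_ iK].
have m0 : 0 < m by apply: leq_ltn_trans um.
rewrite /edge_colour; case: eqP => ouv.
  by have : (u./2 + v./2) %% m < m; [rewrite ltn_mod | lia].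
move/addnI => eq; exists i => //; split=> //; by case: (odd v) eq => <-; rewrite shiftK.
Qed.

(** [u], [v] lie on one side and [x], [y] on the other. The four edges give the two congruences of
    [sidon_mod], based at the pair on the even side. *)
Lemma sidon_colours_C4_free K u v x y : 2 ^ K < m ->
  u./2 < m -> v./2 < m -> x./2 < m -> y./2 < m -> u != v ->
  edge_colour u x \in sidon_colours K -> edge_colour u y \in sidon_colours K ->
  edge_colour v x \in sidon_colours K -> edge_colour v y \in sidon_colours K ->
  x = y.
Proof.
move=> Km um vm xm ym uv.
have half_inj a c : odd a = odd c -> a./2 = c./2 -> a = c.
  by move=> o h; rewrite -(odd_double_half a) -(odd_double_half c) o h.
move=> /sidon_coloursP[] // i iK [oux ui] /sidon_coloursP[] // k kK [ouy uk].
move=> /sidon_coloursP[] // j jK [ovx vj] /sidon_coloursP[] // l lK [ovy vl].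
have ouv : odd u = odd v by case: (odd u) (odd v) (odd x) oux ovx => [] [] [].
have oxy : odd x = odd y by case: (odd u) (odd x) (odd y) oux ouy => [] [] [].
apply: (half_inj x y) => //; rewrite -oxy in uk vl.
case: (odd x) ui uk vj vl => ui uk vj vl.
  have [//|||ik|/(half_inj _ _ ouv) eq] := @sidon_mod K u./2 v./2 i j k l Km um vm.
  - by rewrite -ui -vj.
  - by rewrite -uk -vl.
  - by rewrite ui uk ik.
  - by rewrite eq eqxx in uv.
have [//|||ij|//] := @sidon_mod K x./2 y./2 i k j l Km xm ym.
- by rewrite -ui -uk.
- by rewrite -vj -vl.
by case/eqP: uv; apply: half_inj => //; rewrite ui vj ij.
Qed.

Lemma size_other_colours K : 2 ^ K < m ->
  size [seq c <- iota 0 (2 * m) | c \notin sidon_colours K] + K = 2 * m.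
Proof.
move=> Km; have us : uniq (sidon_colours K).
  rewrite map_inj_uniq ?iota_uniq // => i j /addnI; exact: expnI.
have : perm_eq [seq c <- iota 0 (2 * m) | c \in sidon_colours K] (sidon_colours K).
  apply: uniq_perm => //; first by rewrite filter_uniq ?iota_uniq.
  move=> c; rewrite mem_filter mem_iota; case: (boolP (c \in _)) => //= /mapP[i].
  rewrite mem_iota => /andP[_ iK] ->; apply/idP.
  have : 2 ^ i <= 2 ^ K by rewrite leq_exp2l // ltnW.
  lia.
move/perm_size; rewrite [size (sidon_colours _)]size_map size_iota !size_filter => eqK.
by rewrite -[in X in _ + X]eqK addnC count_predC size_iota.
Qed.

End Colouring.

Lemma breaker_wins_large first n b :
  2 ^ 512 < uphalf n -> n <= b -> breaker_wins first n b.
Proof.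
(* An opaque [K] keeps [2 ^ 512] from being computed. *)
have [K eqK] : exists K, K = 512 by exists 512.
rewrite -eqK => Km nb.
suff win : breaker_wins Maker n b.
  (* A Breaker who moves first passes. *)
  case: first => //; apply: (@breaker_forces_move _ _ _ _ set0).
  - move=> /setP U0; have n1 : 1 < n by move: (expn_gt0 2 K) Km; lia.
    have := U0 [set Ordinal (ltnW n1); Ordinal n1].
    by rewrite pair_unclaimed // !inE.
  - exact: breaker_move0.
  - by rewrite set0U.
pose m := uphalf n.
have half_lt (u : 'I_n) : u./2 < m.
  by rewrite /m; have := ltn_ord u; rewrite uphalf_half; lia.
have m0 : 0 < m by apply: leq_ltn_trans Km.
pose col (u v : 'I_n) := edge_colour m u v.
have colC u v : col u v = col v u by apply: edge_colourC.
have colI u : injective (col u).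
  by move=> v w /edge_colour_inj eq; apply: val_inj; apply: eq.
pose cs := [seq c <- iota 0 (2 * m) | c \notin sidon_colours m K].
have scs : size cs + K = 2 * m by apply: size_other_colours.
(* The opening leaves Maker at most 2m - K <= n + 1 - K edges. *)
apply: (@breaker_wins_opening _ _ col nb colC colI cs (sidon_colours m K) (2 * m - K)).
- exact: sub0set.
- move=> u v _; rewrite mem_cat mem_filter mem_iota.
  by rewrite edge_colour_lt // andbT; case: (_ \in _).
- by rewrite cards0 -scs addnK.
move=> M B sM cU cM; apply: (@breaker_wins_C4_free _ _ col nb colC colI (sidon_colours m K)) => //.
- move=> u v x y uv ux uy vx vy; apply: val_inj.
  exact: (sidon_colours_C4_free Km (half_lt u) (half_lt v) (half_lt x) (half_lt y) uv ux uy vx vy).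
- by rewrite size_map size_iota.
- move: cM scs; rewrite /m uphalf_half; rewrite -eqK; lia.
Qed.

(** * Maker wins for small bias *)

Section MakerWins.

Lemma sorted_cat_cons (T : Type) (r : rel T) s1 x s2 :
  sorted r (s1 ++ x :: s2) = sorted r (rcons s1 x) && path r x s2.
Proof. by case: s1 => //= a s1; rewrite rcons_path cat_path /= andbA. Qed.

(** Cut [s] into triples: if each met [P], then [size s <= 3 * count P s + 2]. *)
Lemma three_consecutive (T : Type) (P : pred T) s : 3 * count P s + 3 <= size s ->
  exists s1 x y z s2,
    s = s1 ++ [:: x, y, z & s2] /\ [&& ~~ P x, ~~ P y & ~~ P z].
Proof.
have [k] := ubnP (size s); elim: k s => // k IH [|x [|y [|z s]]] /= sk; try lia.
case: (boolP [&& ~~ P x, ~~ P y & ~~ P z]) => [ok _|bad le].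
  by exists [::], x, y, z, s.
have [| |s1 [x' [y' [z' [s2 [-> ok]]]]]] := IH s; first lia.
  by move: bad le; do 3 case: (P _) => /=; lia.
by exists [:: x, y, z & s1], x', y', z', s2.
Qed.

Variables (n b D N : nat).
Implicit Types (M B S E : {set {set 'I_n}}) (e : {set 'I_n}) (u v w : 'I_n)
  (s : seq 'I_n).

(** Each [x] in [t] rules out only itself and its neighbours in [E]. *)
Lemma exists_free (F : {set 'I_n}) E (t : seq 'I_n) :
  \sum_(x <- t) (degree E x).+1 < #|F| ->
  exists2 u, u \in F & {in t, forall x, x != u /\ [set x; u] \notin E}.
Proof.
elim: t F => [|x t IH] F; first by rewrite big_nil => /card_gt0P[u uF]; exists u.
rewrite big_cons => ltF; pose F' := [set u in F | (x != u) && ([set x; u] \notin E)].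
have [|u] := IH F'.
  have : #|F| <= #|F'| + (#|[set u in F | [set x; u] \in E]| + #|[set x]|).
    apply: leq_trans (leq_add (leqnn _) (leq_card_setU _ _)).
    apply: leq_trans (leq_card_setU _ _); apply: subset_leq_card.
    apply/subsetP=> u uF; rewrite !inE uF /= eq_sym.
    by case: (u == x); case: (_ \in E).
  by have := card_neighbours E x F; rewrite cards1; move: ltF; lia.
rewrite inE => /and3P[uF xu xuE] Hu; exists u => // y.
by rewrite inE => /orP[/eqP->|/Hu].
Qed.

Lemma breaker_move_effect M B S : breaker_move b M B S -> B \subset edges n ->
  [/\ S :|: B \subset edges n, #|S :|: B| <= #|B| + b &
      forall v, degree (S :|: B) v <= degree B v + 1].
Proof.
case/and3P=> sS cS tS sB; split.
- by rewrite subUset sB andbT; apply: subset_trans sS (subsetDl _ _).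
- by apply: leq_trans (leq_card_setU S B) _; rewrite addnC leq_add2l.
move=> v; apply: leq_trans (degree_setU S B v) _.
by rewrite addnC leq_add2l degree_trivIset.
Qed.

Lemma breaker_move_fork M B S u v w : breaker_move b M B S -> v != w ->
  [set u; v] \notin B -> [set u; w] \notin B ->
  ([set u; v] \notin S :|: B) || ([set u; w] \notin S :|: B).
Proof.
case/and3P=> _ _ tS vw /negbTE uvB /negbTE uwB; rewrite !inE uvB uwB !orbF.
rewrite -negb_and; apply/negP=> /andP[uvS uwS].
have /setP/(_ v) := trivIset_meet tS uvS uwS (set21 _ _) (set21 _ _).
rewrite !inE eqxx orbT (negbTE vw) orbF => /esym/eqP vu.
have /setP/(_ w) := trivIset_meet tS uvS uwS (set21 _ _) (set21 _ _).
by rewrite !inE eqxx orbT vu orbb -vu eq_sym (negbTE vw).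
Qed.

Definition danger s B j := [set v | (v \notin s) && (D + 3 * j <= degree B v)].

Lemma card_danger0 s B : B \subset edges n -> D * #|danger s B 0| <= 2 * #|B|.
Proof.
move=> sB; rewrite -(sum_degree_edges sB) mulnC -sum_nat_const big_mkcond.
by apply: leq_sum => v _; rewrite inE muln0 addn0; case: ifP => // /andP[].
Qed.

(* While Maker absorbs a vertex of largest degree, the other degrees grow by at
   most 3, so the threshold of the danger sets may be raised by 3. *)
Lemma card_danger_step s s' B B' w j :
  (forall v, v \notin s -> degree B v <= degree B w) -> w \notin s ->
  {subset s <= s'} -> w \in s' ->
  (forall v, degree B' v <= degree B v + 3) ->
  #|danger s' B' j.+1| <= #|danger s B j|.-1.
Proof.
move=> maxw ws ss' ws' leB; have [->|[v]] := set_0Vmem (danger s' B' j.+1).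
  by rewrite cards0.
rewrite inE => /andP[vs' dv]; have vs : v \notin s by apply: contra vs'; apply: ss'.
have wd : w \in danger s B j.
  by rewrite inE ws; have := maxw v vs; have := leB v; lia.
rewrite (cardsD1 w (danger s B j)) wd /=; apply: subset_leq_card.
apply/subsetP=> u; rewrite !inE => /andP[us' du]; apply/and3P; split.
- by apply: contraNneq us' => ->.
- by apply: contra us'; apply: ss'.
- by have := leB u; lia.
Qed.

(** In a Maker position at most [N] vertices are dangerous and level [N] is empty, so Breaker
    degrees off the path stay below [H]. *)
Let H := D + 3 * N.

(** [position_support] keeps vertices off the path free of Maker edges. [position_card] allows three
    Breaker turns per path vertex and an opening move. [position_head] serves the phase in which the
    path grows at its head. *)
Record maker_position s M B : Prop := MakerPosition {
  position_uniq : uniq s;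
  position_sorted : sorted (adjacent M) s;
  position_support : forall e v, e \in M -> v \in e -> v \in s;
  position_edges : B \subset edges n;
  position_card : #|B| <= b * (3 * size s + 1);
  position_danger : forall j, #|danger s B j| <= N - j;
  position_head : forall x p, s = x :: p -> size s + 4 * H + 20 <= n ->
    degree B x <= H + 3 }.

Hypothesis few_edges : 2 * (b * (3 * n + 1)) < D * N.+1.
Hypothesis large_n : 7 * H + 40 <= n.

Lemma position_degree s M B v :
  maker_position s M B -> v \notin s -> degree B v < H.
Proof.
move=> pos vs; have := position_danger pos N; rewrite subnn leqn0 cards_eq0.
move=> /eqP/setP/(_ v); rewrite !inE vs /= -/H => /negbT; lia.
Qed.

Definition fresh_set s : {set 'I_n} := [set v | v \notin s].

Lemma size_fresh s : uniq s -> #|fresh_set s| + size s = n.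
Proof.
move=> us; have := cardC (mem s); rewrite card_ord (card_uniqP us) addnC => eqn.
rewrite -[RHS]eqn; congr (_ + _); apply: eq_card => v.
by rewrite !inE.
Qed.

Lemma uniq_size_le s : uniq s -> size s <= n.
Proof. by move=> /size_fresh; lia. Qed.

Lemma maker_position_step s s' M M' B B' w :
  maker_position s M B -> w \notin s ->
  (forall v, v \notin s -> degree B v <= degree B w) ->
  uniq s' -> sorted (adjacent M') s' ->
  (forall e v, e \in M' -> v \in e -> v \in s') ->
  {subset s <= s'} -> w \in s' ->
  B' \subset edges n -> #|B'| <= #|B| + 3 * b ->
  (forall v, degree B' v <= degree B v + 3) ->
  (forall x p, s' = x :: p -> size s' + 4 * H + 20 <= n -> degree B' x <= H + 3) ->
  maker_position s' M' B'.
Proof.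
move=> pos ws maxw us' ss' sup sub ws' sB' cB' dB' hd.
have lt_size : size s < size s'.
  apply: (@uniq_leq_size _ (w :: s)); first by rewrite /= ws (position_uniq pos).
  by move=> v; rewrite inE => /orP[/eqP->|/sub].
have cB : #|B'| <= b * (3 * size s' + 1) by have := position_card pos; nia.
(* Level 0 is bounded by counting edges against [few_edges], level [j.+1] by level [j] before the
   step. *)
split=> //; case=> [|j].
  have := card_danger0 s' sB'; have := uniq_size_le us'; move: few_edges cB.
  set c := #|_|; set d := #|_|; rewrite subn0; nia.
have := card_danger_step j maxw ws sub ws' dB'; have := position_danger pos j; lia.
Qed.

Lemma fresh_pair_unclaimed s M B u v :
  (forall e v, e \in M -> v \in e -> v \in s) -> u \notin s -> u != v ->
  [set u; v] \notin B -> [set u; v] \in unclaimed M B.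
Proof.
move=> sup us uv uvB; rewrite pair_unclaimed // uvB andbT.
by apply: contra us => uvM; apply: sup uvM (set21 _ _).
Qed.

Lemma adjacentC M : symmetric (adjacent M).
Proof. by move=> u v; rewrite /adjacent /= setUC. Qed.

Lemma sorted_move M e s : sorted (adjacent M) s -> sorted (adjacent (e |: M)) s.
Proof. by apply: sub_sorted => u v; rewrite /adjacent /= !inE orbC => ->. Qed.

(* Maker claims an edge wy off the path and then extends the path to a vertex u
   from which both w and y are free: one of uw, uy survives Breaker's reply. *)
Lemma maker_extends s M B w :
  maker_position s M B -> 0 < size s -> size s + 4 * H + 20 <= n ->
  w \notin s -> (forall v, v \notin s -> degree B v <= degree B w) ->
  (forall s' M' B', size s < size s' -> maker_position s' M' B' ->
     maker_forces b Maker M' B') ->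
  maker_forces b Maker M B.
Proof.
move=> pos s0 les ws maxw next.
have [v [p es]] : exists v p, s = v :: p.
  by case: s s0 {pos les ws maxw next} => // v p; exists v, p.
have us := position_uniq pos; have sup := position_support pos.
have fresh := size_fresh us.
have dv : degree B v <= H + 3 by apply: (position_head pos es) les.
have dfresh := position_degree pos.
have [|y] := @exists_free (fresh_set s) B [:: w].
  by rewrite big_seq1; have := dfresh w ws; lia.
rewrite inE => ys Hy; have [wy wyB] := Hy w (mem_head _ _).
apply: (@maker_forces_turn _ _ _ _ [set w; y]).
  exact: fresh_pair_unclaimed sup ws wy wyB.
move=> S1 mS1; have [eB1 cB1 dB1] := breaker_move_effect mS1 (position_edges pos).
move: (S1 :|: B) eB1 cB1 dB1 => B1 eB1 cB1 dB1.
(* At most [3 * H + 7] of the at least [4 * H + 20] fresh vertices are ruled out. *)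
have [|u] := @exists_free (fresh_set s) B1 [:: v; w; y].
  rewrite 2!big_cons big_seq1; have := dfresh w ws; have := dfresh y ys.
  by have := dB1 v; have := dB1 w; have := dB1 y; lia.
rewrite inE => us' Hu; have [vu vuB] := Hu v (mem_head _ _).
have [wu wuB] : w != u /\ [set w; u] \notin B1.
  by apply: Hu; rewrite !inE eqxx !orbT.
have [yu yuB] : y != u /\ [set y; u] \notin B1.
  by apply: Hu; rewrite !inE eqxx !orbT.
have uv : u != v by rewrite eq_sym.
apply: (@maker_forces_turn _ _ _ _ [set u; v]).
  rewrite pair_unclaimed // setUC vuB andbT !inE negb_or; apply/andP; split.
    apply/eqP=> /setP/(_ u); rewrite !inE eqxx eq_sym (negbTE vu) /=.
    by rewrite !(eq_sym u) (negbTE wu) (negbTE yu).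
  by apply: contra us' => vuM; apply: sup vuM _; rewrite set22.
move=> S2 mS2; have [eB2 cB2 dB2] := breaker_move_effect mS2 eB1.
have fork := breaker_move_fork mS2 wy.
move: (S2 :|: B1) eB2 cB2 dB2 fork => B2 eB2 cB2 dB2 fork; set M2 := [set u; v] |: _.
(* [z1], [z2] are [w], [y] in the order that Breaker's reply leaves open; the new path is [z1],
   [z2], [u], then [s]. *)
have fin z1 z2 : z1 \notin s -> z2 \notin s -> z1 != z2 -> z1 != u -> z2 != u ->
    w \in [:: z1; z2] -> [set z1; z2] = [set w; y] -> [set u; z2] \notin B2 ->
    maker_forces b Maker M2 B2.
  move=> z1s z2s z12 z1u z2u wz eqwy uzB.
  have zM2 : [set u; z2] \notin M2.
    rewrite /M2 !inE !negb_or; apply/and3P; split.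
    - apply/eqP=> /setP/(_ z2); rewrite !inE eqxx orbT (negbTE z2u) /=.
      by move=> /esym/eqP zv; rewrite es zv mem_head in z2s.
    - rewrite -eqwy; apply/eqP=> /setP/(_ u); rewrite !inE eqxx /=.
      by rewrite !(eq_sym u) (negbTE z1u) (negbTE z2u).
    - by apply: contra us' => uzM; apply: sup uzM (set21 _ _).
  apply: (@maker_forces_turn _ _ _ _ [set u; z2]).
    by rewrite pair_unclaimed 1?eq_sym // zM2.
  move=> S3 mS3; have [eB3 cB3 dB3'] := breaker_move_effect mS3 eB2.
  move: (S3 :|: B2) eB3 cB3 dB3' => B3 eB3 cB3 dB3'.
  have dB3 x : degree B3 x <= degree B x + 3.
    by have := dB1 x; have := dB2 x; have := dB3' x; clear; lia.
  apply: (next [:: z1, z2, u & s]); first by rewrite /= !ltnS leqW.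
  apply: (maker_position_step (w := w) pos) => //.
  - by rewrite /= !inE !negb_or z12 z1u z2u z1s z2s us' us.
  - have eq1 : [set z1; z2] \in [set u; z2] |: M2 by rewrite eqwy !inE eqxx !orbT.
    have eq2 : [set z2; u] \in [set u; z2] |: M2 by rewrite [[set z2; u]]setUC setU11.
    have eq3 : [set u; v] \in [set u; z2] |: M2 by rewrite !inE eqxx !orbT.
    rewrite es /= {1 2 3}/adjacent /= eq1 eq2 eq3 /=.
    by do 3 apply: (@sorted_move _ _ (v :: p)); rewrite -es; apply: position_sorted pos.
  - move=> e x; rewrite !inE => /or4P[/eqP->|/eqP->|/eqP->|eM] xe.
    + by move: xe; rewrite !inE => /orP[]->; rewrite ?orbT.
    + by move: xe; rewrite es !inE => /orP[]->; rewrite ?orbT.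
    + by move: xe; rewrite -eqwy !inE => /orP[]->; rewrite ?orbT.
    + by have := sup _ _ eM xe; move=> ->; rewrite !orbT.
  - by move=> x xs; rewrite !inE xs !orbT.
  - by move: wz; rewrite !inE => /orP[]->; rewrite ?orbT.
  - by move: cB1 cB2 cB3; clear; lia.
  (* The new head [z1] was off the path, with degree below [H], and gained at most 3. *)
  - by move=> x q [<- _] _; have := dB3 z1; have := dfresh _ z1s; clear; lia.
have := fork u.
rewrite ![[set u; _]]setUC => /(_ wuB yuB) /orP[nB|nB].
  apply: (fin y w) => //; first by rewrite eq_sym.
  - by rewrite !inE eqxx orbT.
  - by rewrite setUC.
  - by rewrite setUC.
apply: (fin w y) => //; first by rewrite mem_head.
by rewrite setUC.
Qed.

(* Maker claims wy for three consecutive path vertices x, y, z free from w: one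
   of wx, wz survives Breaker's reply and inserts w next to y. *)
Lemma maker_inserts s M B w :
  maker_position s M B -> n < size s + 4 * H + 20 ->
  w \notin s -> (forall v, v \notin s -> degree B v <= degree B w) ->
  (forall s' M' B', size s < size s' -> maker_position s' M' B' ->
     maker_forces b Maker M' B') ->
  maker_forces b Maker M B.
Proof.
move=> pos ltn ws maxw next.
have us := position_uniq pos; have sup := position_support pos.
have dw := position_degree pos ws.
(* Fewer than [H] path vertices are blocked, and the path has more than n - 4H - 20 >= 3H + 20
   vertices. *)
have [|s1 [x [y [z [s2 [eqs /and3P[wxB wyB wzB]]]]]]] :=
    @three_consecutive _ (fun v => [set w; v] \in B) s.
  suff : count (fun v => [set w; v] \in B) s <= degree B w by lia.
  apply: leq_trans (card_neighbours B w [set v in s]); rewrite -size_filter.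
  rewrite -(card_uniqP (filter_uniq _ us)); apply: subset_leq_card.
  by apply/subsetP=> v; rewrite mem_filter !inE andbC.
have [wx wy wz] : [/\ w != x, w != y & w != z].
  by move: ws; rewrite eqs mem_cat !inE !negb_or => /and5P[].
apply: (@maker_forces_turn _ _ _ _ [set w; y]).
  exact: fresh_pair_unclaimed sup ws wy wyB.
move=> S1 mS1; have [eB1 cB1 dB1] := breaker_move_effect mS1 (position_edges pos).
have fork := breaker_move_fork mS1 _ wxB wzB.
move: (S1 :|: B) eB1 cB1 dB1 fork => B1 eB1 cB1 dB1 fork.
have [xy [yz xz]] : x != y /\ y != z /\ x != z.
  move: us; rewrite eqs cat_uniq => /and3P[_ _] /=; rewrite !inE !negb_or.
  by case/andP=> /and3P[-> -> _] /andP[/andP[-> _] _].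
(* [v] is whichever of [x], [z] survives; [s'] has [w] inserted between [v] and [y]. *)
have fin v s' : v \in s -> y != v -> w != v -> [set w; v] \notin B1 ->
    perm_eq s' (w :: s) ->
    sorted (adjacent ([set w; v] |: ([set w; y] |: M))) s' ->
    maker_forces b Maker ([set w; y] |: M) B1.
  move=> vs yv wv wvB eqs' ss'.
  have ms' : s' =i w :: s by apply: perm_mem.
  apply: (@maker_forces_turn _ _ _ _ [set w; v]).
    rewrite pair_unclaimed // wvB andbT !inE negb_or; apply/andP; split.
      apply/eqP=> /setP/(_ v); rewrite !inE eqxx orbT.
      by rewrite !(eq_sym v) (negbTE wv) (negbTE yv).
    by apply: contra ws => wvM; apply: sup wvM (set21 _ _).
  move=> S2 mS2; have [eB2 cB2 dB2] := breaker_move_effect mS2 eB1.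
  move: (S2 :|: B1) eB2 cB2 dB2 => B2 eB2 cB2 dB2.
  apply: (next s'); first by rewrite (perm_size eqs').
  apply: (maker_position_step (w := w) pos) => //.
  - by rewrite (perm_uniq eqs') /= ws.
  - move=> e t; rewrite ms' !inE => /or3P[/eqP->|/eqP->|eM] te.
    + by move: te; rewrite !inE => /orP[->//|/eqP->]; rewrite vs orbT.
    + move: te; rewrite !inE => /orP[->//|/eqP->].
      by rewrite eqs mem_cat !inE eqxx !orbT.
    + by rewrite (sup _ _ eM te) orbT.
  - by move=> t ts; rewrite ms' inE ts orbT.
  - by rewrite ms' mem_head.
  - by move: cB1 cB2; clear; lia.
  - by move=> t; have := dB1 t; have := dB2 t; clear; lia.
  - by move=> t q _; rewrite (perm_size eqs') /=; move: ltn; clear; lia.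
have srt e : sorted (adjacent (e |: ([set w; y] |: M))) s.
  by do 2 apply: sorted_move; apply: position_sorted pos.
have wyM e : [set w; y] \in e |: ([set w; y] |: M) by rewrite !inE eqxx orbT.
have /orP[nB|nB] := fork xz.
  apply: (fin x (s1 ++ [:: x, w, y, z & s2])) => //.
  - by rewrite eqs mem_cat mem_head orbT.
  - by rewrite eq_sym.
  - by rewrite eqs; apply/permP=> a; rewrite /= !count_cat /=; clear; lia.
  have := srt [set w; x]; rewrite eqs !sorted_cat_cons => /andP[->] /= /andP[_ ->].
  by rewrite andbT {2}/adjacent /= wyM adjacentC /adjacent /= setU11.
apply: (fin z (s1 ++ [:: x, y, w, z & s2])) => //.
- by rewrite eqs mem_cat !inE eqxx !orbT.
- by rewrite eqs; apply/permP=> a; rewrite /= !count_cat /=; clear; lia.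
have := srt [set w; z]; rewrite eqs !sorted_cat_cons => /andP[->] /=.
case/and3P=> -> _ -> /=.
by rewrite andbT adjacentC /adjacent /= wyM setU11.
Qed.

Lemma maker_wins_position s M B :
  maker_position s M B -> 0 < size s -> maker_forces b Maker M B.
Proof.
have [k] := ubnP (n - size s); elim: k s M B => // k IH s M B lek pos s0.
have us := position_uniq pos; have fresh := size_fresh us.
have [s_all|[w0]] := set_0Vmem (fresh_set s).
  apply: maker_forces_hamiltonian; exists s; split=> //; last exact: position_sorted pos.
  by move=> v; apply/negPn; have /setP/(_ v) := s_all; rewrite !inE => ->.
rewrite inE => w0s.
have [w ws maxw] := @arg_maxnP _ w0 (fun v => v \notin s) (degree B) w0s.
have next s' M' B' : size s < size s' -> maker_position s' M' B' ->
    maker_forces b Maker M' B'.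
  move=> lts pos'; have les' := uniq_size_le (position_uniq pos').
  by apply: IH pos' _; [move: lek lts les'; clear; lia | apply: leq_trans lts].
have [le|lt] := leqP (size s + 4 * H + 20) n.
  exact: maker_extends pos s0 le ws maxw next.
exact: maker_inserts pos lt ws maxw next.
Qed.

(** Maker starts from a one-vertex path. An opening move of Breaker is a matching, so degrees are at
    most 1 and no vertex is dangerous. *)
Lemma maker_wins_small first : 1 < D -> maker_wins first n b.
Proof.
move=> D1; have n0 : 0 < n by lia.
have start B : B \subset edges n -> #|B| <= b -> (forall v, degree B v <= 1) ->
    maker_forces b Maker set0 B.
  move=> sB cB dB; apply: (@maker_wins_position [:: Ordinal n0]) => //; split=> //.
  - by move=> e v; rewrite inE.
  - by apply: leq_trans cB _; rewrite leq_pmulr.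
  - move=> j; rewrite (_ : danger _ _ _ = set0) ?cards0 //.
    apply/setP=> v; rewrite !inE; apply/negP=> /andP[_]; have := dB v; lia.
  - by move=> x p _ _; have := dB x; lia.
case: first.
  apply: start; rewrite ?sub0set ?cards0 // => v.
  by rewrite /degree (_ : [set _ in _ | _] = set0) ?cards0 //; apply/setP=> e; rewrite !inE.
apply: maker_forces_reply => [/setP U0|S mS].
  have n1 : 1 < n by lia.
  have := U0 [set Ordinal n0; Ordinal n1].
  by rewrite pair_unclaimed // !inE.
rewrite setU0; case/and3P: mS => sS cS tS; apply: start => //.
  exact: subset_trans sS (subsetDl _ _).
by move=> v; apply: degree_trivIset.
Qed.

End MakerWins.

(** * The threshold bias *)

(** Zermelo's backward induction on the number of unclaimed edges. *)
Lemma forces_determined n b p (M B : {set {set 'I_n}}) :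
  ~ maker_forces b p M B -> breaker_forces b p M B.
Proof.
have [k] := ubnP #|unclaimed M B|; elim: k p M B => // k IH p M B lek notM.
have noham M' B' p' : unclaimed M' B' = set0 -> ~ maker_forces b p' M' B' ->
    breaker_forces b p' M' B'.
  by move=> U0 nM; apply: breaker_forces_end => // hM; apply: nM; apply: maker_forces_end.
(* Breaker may claim nothing and leave the board as large, so positions with Maker to move come
   first. *)
have turn B' : #|unclaimed M B'| <= k -> ~ maker_forces b Maker M B' ->
    breaker_forces b Maker M B'.
  move=> lek' nM; have [U0|/eqP U0] := eqVneq (unclaimed M B') set0; first exact: noham.
  apply: breaker_forces_reply => // e eU; apply: IH.
    exact: leq_trans (card_unclaimed_move eU) lek'.
  by move=> me; apply: nM; apply: maker_forces_move me.
have [U0|/eqP U0] := eqVneq (unclaimed M B) set0; first exact: noham.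
case: p notM => notM; first exact: turn.
have [S mS nS] : exists2 S, breaker_move b M B S & ~ maker_forces b Maker M (S :|: B).
  apply: contrapT => noS; apply: notM; apply: maker_forces_reply => // S mS.
  by apply: contrapT => nM; apply: noS; exists S.
apply: (breaker_forces_move U0 mS); apply: turn nS.
rewrite ltnS in lek; apply: leq_trans lek; apply: subset_leq_card; apply/subsetP=> e.
by rewrite !mem_unclaimed !inE negb_or => /and3P[-> -> /andP[]].
Qed.

Lemma maker_wins_linear first n : 3827 <= n -> maker_wins first n (n %/ 3827).
Proof.
move=> n_ge; set b := n %/ 3827; pose q := n %/ 43.
have nq : n < 43 * q + 43 by rewrite /q; lia.
have qn : 43 * q <= n by rewrite /q; lia.
have bq : 89 * b <= q by rewrite /q /b; lia.
have q_ge : 89 <= q by rewrite /q; lia.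
(* [D = 3 * q] and [N = q] give [H = 6 * q], and 42q + 40 <= 43q <= n. As 3827 = 43 * 89, 266b <=
   267b <= 3q, which gives the edge bound. *)
clearbody b q; apply: (@maker_wins_small n b (3 * q) q); [|lia|lia].
have : 2 * (b * (3 * n + 1)) <= 2 * (b * (133 * q)).
  by rewrite leq_mul2l leq_mul2l; lia.
nia.
Qed.

Lemma threshold_bias_exists first n : 3827 <= n -> 2 ^ 512 < uphalf n ->
  exists2 b0, is_threshold_bias first n b0 & n %/ 3827 <= b0 <= n.
Proof.
move=> n_ge n_large; pose P b := `[< maker_wins first n b >].
have exP : exists b, P b by exists (n %/ 3827); apply/asboolP/maker_wins_linear.
have boundP b : P b -> b <= n.
  move=> /asboolP Mb; rewrite leqNgt; apply/negP=> /ltnW nb.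
  exact: forces_exclusive Mb (breaker_wins_large first n_large nb).
case: (ex_maxnP exP boundP) => b0 /asboolP Mb0 maxb0; exists b0; last first.
  by rewrite boundP ?maxb0 //; apply/asboolP => //; apply: maker_wins_linear.
split=> b b_b0; last exact: maker_forces_antimono b_b0 Mb0.
apply: forces_determined => Mb; move: b_b0; rewrite ltnNge maxb0 //.
exact/asboolP.
Qed.

(** * The asymptotic form *)

Unset Implicit Arguments.
Set Strict Implicit.
Set Printing Implicit Defensive.

From mathcomp Require Import all_order all_algebra.
From mathcomp Require Import all_classical all_reals topology normedtype landau.
Import Order.TTheory GRing.Theory Num.Theory.
Import numFieldNormedType.Exports.
Local Open Scope ring_scope.
Local Open Scope classical_set_scope.

Theorem theorem4p4 (R : realType) (first : player) :
  exists b0 : nat -> nat,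
    (\forall n \near \oo, is_threshold_bias first n (b0 n)) /\
    (fun n : nat => (b0 n)%:R : R) =Theta_\oo (fun n : nat => n%:R : R).
Proof.
have [n0 thr] : exists n0, forall n, (n0 <= n)%N ->
    exists2 b0, is_threshold_bias first n b0 & (n <= 2 * 3827 * b0)%N && (b0 <= n)%N.
  exists (maxn 3827 (2 ^ 512).*2.+2) => n; rewrite geq_max => /andP[n1 n2].
  have [|b0 thr /andP[lo hi]] := @threshold_bias_exists first n n1.
    by move: n2; rewrite uphalf_half; generalize (2 ^ 512)%N; lia.
  (* The quotient is at least 1, so rounding down costs at most a factor 2. *)
  by exists b0; rewrite // hi andbT; lia.
have /choice[b0 b0P] : forall n, exists b0, (n0 <= n)%N ->
    is_threshold_bias first n b0 /\ (n <= 2 * 3827 * b0)%N && (b0 <= n)%N.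
  move=> n; have [/thr[b0 tb0 leb0]|] := leqP n0 n; first by exists b0.
  (* A default value below [n0]. *)
  by exists 0%N.
exists b0; split; first by exists n0 => // n /= /b0P[].
rewrite eqThetaE; apply/asboolP.
exists ((2 * 3827)%:R^-1, 1) => /=; first by rewrite ltr01 invr_gt0 ltr0n.
exists n0 => // n /= /b0P[_ /andP[lo hi]].
rewrite !normr_nat mul1r !ler_nat; split=> //.
by rewrite ler_pdivrMl ?ltr0n // -natrM ler_nat.
Qed.
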